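(* There exists a convex equilateral small $64$-gon whose perimeter exceeds that of $A_{64}$, where $A_{64}$ is the convex equilateral small $64$-gon defined in the context.
   Context: Polygons are in the Euclidean plane. The diameter of a polygon is the largest distance between any pair of its vertices. A polygon is small if its diameter equals $1$. It is equilateral if all its sides have the same length. Definition of $A_n$ for $n=2^s$, $s\ge 4$ (used here with $n=64$). For $t\in(0,\pi/n)$ let $u_j(t)=(\sin jt,\cos jt)$. Let $j_1<j_2<\cdots<j_{3n/8-1}$ be the elements, in increasing order, of $\{1,2,\ldots,n/2-1\}\setminus\{4k-2 : 1\le k\le n/8\}$. Put $p_0=(0,0)$ and $$p_i = p_{i-1}+(-1)^{i-1}u_{j_i}(t),\qquad 1\le i\le 3n/8-1,$$ and $$q_k = p_{3k-2}+(-1)^k u_{4k-2}(t),\qquad 1\le k\le n/8.$$ Let $\rho(x,y)=(-x,y)$. Let $t$ be the largest solution in $(0,\pi/n)$ of the equation $$\|p_{3n/8-2}-\rho(p_{3n/8-1})\| = 2\sin(t/2).$$ Equivalently, writing $x=\sin t - \frac{(2\cos t-1)(\sin 2t+\sin((n/2-2)t))}{2\cos 2t}$ for the abscissa of $p_{3n/8-2}$, this equation is $(2x+\sin((n/2-1)t))^2+\cos^2((n/2-1)t)=4\sin^2(t/2)$. With this value of $t$, $A_n$ is the polygon whose $n$ vertices are $(0,0)$, $(0,1)$, the points $p_1,\ldots,p_{3n/8-1}$, the points $q_1,\ldots,q_{n/8}$, and the images under $\rho$ of all the points $p_i$ ($i\ge 1$) and $q_k$; it is the convex hull of these points. It is a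 convex equilateral small $n$-gon with side length $2\sin(t/2)$, so its perimeter is $2n\sin(t/2)$; for $n=64$ this perimeter is $3.1412717079\ldots$ *)

(* Defs.v *)
From Stdlib Require Import Reals List Permutation Arith.
Import ListNotations.
Open Scope R_scope.

Definition point : Type := (R * R)%type.

Definition dist (a b : point) : R := dist_euc (fst a) (snd a) (fst b) (snd b).

(** The list of the vertices in cyclic order, in either orientation. *)
Definition polygon : Type := list point.

(** The index is taken modulo the number of vertices. *)
Definition vertex (P : polygon) (i : nat) : point :=
  nth (i mod length P) P (0, 0).

Definition side (P : polygon) (i : nat) : R :=
  dist (vertex P i) (vertex P (S i)).

Definition perimeter (P : polygon) : R :=
  fold_right Rplus 0 (map (side P) (seq 0 (length P))).

Definition diameter (P : polygon) : R :=
  fold_right Rmax 0 (map (fun ab => dist (fst ab) (snd ab)) (list_prod P P)).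

Definition small (P : polygon) : Prop := diameter P = 1.

Definition equilateral (P : polygon) : Prop :=
  forall i j : nat, (i < length P)%nat -> (j < length P)%nat -> side P i = side P j.

(** Twice the signed area of the triangle [a b c]. *)
Definition orient (a b c : point) : R :=
  (fst b - fst a) * (snd c - snd a) - (snd b - snd a) * (fst c - fst a).

(** For every side, all the other vertices lie strictly on one side of the line
    that carries it. Strictness makes each listed point a genuine vertex: the
    points are distinct, and none is in the convex hull of the others. *)
Definition convex (P : polygon) : Prop :=
  (3 <= length P)%nat /\
  forall i : nat, (i < length P)%nat ->
    let others k := (k < length P)%nat /\ k <> i /\ k <> (S i mod length P)%nat in
    let o k := orient (vertex P i) (vertex P (S i)) (vertex P k) in
    (forall k, others k -> 0 < o k) \/ (forall k, others k -> o k < 0).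

(** The polygon [A_n] is meant for [n = 2 ^ s] with [4 <= s], for which the
    divisions of natural numbers below are exact. *)

Definition u (t : R) (j : nat) : point := (sin (INR j * t), cos (INR j * t)).

Definition skipped (n : nat) : list nat :=
  map (fun k => 4 * k - 2)%nat (seq 1 (n / 8)).

Definition kept (n : nat) : list nat :=
  filter (fun j => negb (existsb (Nat.eqb j) (skipped n))) (seq 1 (n / 2 - 1)).

(** [j_i], indexed from [i = 1]. *)
Definition kept_index (n i : nat) : nat := nth (i - 1) (kept n) 0%nat.

(** [a + (-1) ^ e * v] *)
Definition step (a : point) (e : nat) (v : point) : point :=
  (fst a + (-1) ^ e * fst v, snd a + (-1) ^ e * snd v).

Fixpoint p (n : nat) (t : R) (i : nat) : point :=
  match i with
  | O => (0, 0)
  | S i' => step (p n t i') i' (u t (kept_index n i))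
  end.

Definition q (n : nat) (t : R) (k : nat) : point :=
  step (p n t (3 * k - 2)) k (u t (4 * k - 2)).

Definition rho (a : point) : point := (- fst a, snd a).

Definition closing (n : nat) (t : R) : Prop :=
  dist (p n t (3 * n / 8 - 2)) (rho (p n t (3 * n / 8 - 1))) = 2 * sin (t / 2).

Definition largest_closing (n : nat) (t : R) : Prop :=
  (0 < t < PI / INR n /\ closing n t) /\
  forall t' : R, 0 < t' < PI / INR n -> closing n t' -> t' <= t.

Definition half_vertices (n : nat) (t : R) : list point :=
  map (p n t) (seq 1 (3 * n / 8 - 1)) ++ map (q n t) (seq 1 (n / 8)).

Definition A_vertices (n : nat) (t : R) : list point :=
  [(0, 0); (0, 1)] ++ half_vertices n t ++ map rho (half_vertices n t).

(** [A_n] is given as the convex hull of its [n] vertices, without a cyclic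
    order. Convexity of [A] determines the order up to rotation and reversal,
    and these do not change the perimeter. *)
Definition is_A (n : nat) (A : polygon) : Prop :=
  convex A /\
  exists t : R, largest_closing n t /\ Permutation A (A_vertices n t).

(* Main.v *)
Require Import Defs.
From Stdlib Require Import Reals List.
From Stdlib Require Import Permutation ZArith Arith Bool Lia Lra.
(* Gives [dist] its Euclidean meaning back: the real numbers library has a
   [dist] for abstract metric spaces. *)
Import Defs.
Import ListNotations.
Open Scope R_scope.

(** The polygon [A_64] belongs to a large family. Choose a set [S] of indices in
    [{1, ..., 30}], and walk from the origin with the unit steps [u_j], for [j]
    in [{1, ..., 31}] outside [S], with alternating signs; for [j] in [S], draw
    the step [j] from the current point without moving. The points so obtained,
    [(0, 1)] and the mirror images are 64 points. Consecutive unit segments at a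
    vertex make an angle [t], so that 62 of the 64 sides have length
    [2 sin (t/2)] whatever [t] is. The other two sides are mirror images of each
    other, and have the same length for the roots [t] of one equation,
    [gap = 0]. For [A_64], [S] is [{2, 6, ..., 30}], and the largest root below
    [PI / 64] is about [PI / 64 - 8.66e-8]. For
    [S = {4, 15, 17, 19, 23, 24, 25}], found by a numerical search, there is a
    root at about [PI / 64 - 4.61e-8]. It is larger, hence so is the perimeter
    [128 sin (t/2)].

    The vertices are represented by words that do not depend on [t]. The equality
    of the sides ([side_check_sound]), the fact that the segments of the walk have
    length 1, and the agreement with the vertices of [A_64] ([A_labels_tour]) are
    read off the words. The inequalities are strict, and are proved for all [t] in
    a short interval by a computation with integer balls: convexity
    ([convex_check_sound]) and the bound 1 on the other distances
    ([diameter_check_sound]). The signs of [gap] at the ends of the interval,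
    computed in the same way, give a root ([gap_bracket]). In the case of [A_64], the root must also
    be the largest one below [PI / 64] ([largest_closing_A]): the largest root in
    the interval exists by completeness, and [gap] is negative from the end of
    the interval to beyond [PI / 64], as a subdivision shows ([sweep_sound]). The
    number [PI / 64] is located by the sign of [cos (32 t)], without a close
    estimate of [PI]. *)

(** * Points as signed words *)

(** A word lists the unit steps of a walk from the origin, the last step first;
    [(e, j)] stands for the step [(-1)^e u_j]. *)
Definition word : Type := list (bool * nat).

Fixpoint end_point (t : R) (w : word) : point :=
  match w with
  | [] => (0, 0)
  | (e, j) :: w' => step (end_point t w') (Nat.b2n e) (u t j)
  end.

(** A label is a word, with a flag telling whether its end point is reflected. *)
Definition label : Type := (bool * word)%type.

Definition place (t : R) (v : label) : point :=
  if fst v then rho (end_point t (snd v)) else end_point t (snd v).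

(** The walk with the two chains of vertices that it draws. The current point of
    the walk is [apex], and the segment drawn last joins it to [tip]. The step [j]
    has sign [e] and leads from [apex] to a new vertex [w], next to [tip] on the
    boundary. If [j] is kept, [w] becomes the current point and the sign changes,
    so that the two chains swap their roles. The result is the chain that starts
    with [apex], then the chain that starts with [tip]. *)
Fixpoint fans (keep : list bool) (e : bool) (j : nat) (apex tip : word) :
  list word * list word :=
  match keep with
  | [] => ([apex], [tip])
  | k :: keep' =>
      let w := (e, j) :: apex in
      if k
      then let (c, c') := fans keep' (negb e) (S j) w apex in (c', tip :: c)
      else let (c, c') := fans keep' e (S j) apex w in (c, tip :: c')
  end.

(** The labels of the vertices in cyclic order: the chain from the origin, the
    mirror image of the chain from [(0, 1)] run backwards, and the same with the
    two chains exchanged. The two points on the axis are listed once. *)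
Definition tour (keep : list bool) : list label :=
  let (c0, c1) := fans keep false 1 [] [(false, 0%nat)] in
  map (pair false) c0 ++ map (pair true) (rev (tl c1)) ++
  map (pair false) c1 ++ map (pair true) (rev (tl c0)).

(** The current point at the end of the walk. *)
Fixpoint last_apex (keep : list bool) (e : bool) (j : nat) (apex : word) : word :=
  match keep with
  | [] => apex
  | true :: keep' => last_apex keep' (negb e) (S j) ((e, j) :: apex)
  | false :: keep' => last_apex keep' e (S j) apex
  end.

(** The word of the last point [p_m] of the walk. If the index 31 is kept, the
    tail of this word represents [p_(m-1)], the last vertex of the other chain. *)
Definition path (keep : list bool) : word := last_apex keep false 1 [].

Definition polygon_of (t : R) (keep : list bool) : polygon :=
  map (place t) (tour keep).

(** The indices [j = 1, ..., 31], as flags: [true] when the walk moves along the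
    step [j], [false] when [j] is in [l]. *)
Definition keep_except (l : list nat) : list bool :=
  map (fun j => negb (existsb (Nat.eqb j) l)) (seq 1 31).

Definition keepA : list bool := keep_except (skipped 64).
Definition keepP : list bool := keep_except [4; 15; 17; 19; 23; 24; 25]%nat.

(** If [w] represents [p_m], the squared distance from [p_(m-1)] to the mirror
    image of [p_m], minus the square [2 (1 - cos t)] of the length of the other
    sides. *)
Definition gap (t : R) (w : word) : R :=
  let a := end_point t (tl w) in
  let b := end_point t w in
  (fst a + fst b) * (fst a + fst b) + (snd a - snd b) * (snd a - snd b)
  - 2 * (1 - cos t).

(** * Ball arithmetic *)

(** The scale of the fixed-point numbers. *)
Definition B : Z := (2 ^ 44)%Z.

(** The ball [(m, r)] is the set of the [x] with [|x B - m| <= r]. *)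
Definition ball : Type := (Z * Z)%type.

Definition mem (b : ball) (x : R) : Prop :=
  Rabs (x * IZR B - IZR (fst b)) <= IZR (snd b).

Definition badd (a b : ball) : ball := (fst a + fst b, snd a + snd b)%Z.
Definition bopp (a : ball) : ball := (- fst a, snd a)%Z.
Definition bsub (a b : ball) : ball := badd a (bopp b).
(* Shifting by 44 bits is dividing by [B], rounded down. The 2 added to the
   radius covers the rounding of the centre and that of the radius. *)
Definition bmul (a b : ball) : ball :=
  (Z.shiftr (fst a * fst b) 44,
   Z.shiftr (Z.abs (fst a) * snd b + Z.abs (fst b) * snd a + snd a * snd b) 44 + 2)%Z.
Definition bdiv (a : ball) (n : positive) : ball :=
  (fst a / Zpos n, snd a / Zpos n + 2)%Z.
Definition bint (z : Z) : ball := (z * B, 0)%Z.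
(* Tests that all the elements are negative. *)
Definition bneg (a : ball) : bool := (fst a + snd a <? 0)%Z.
Definition widen (a : ball) : ball := (fst a, snd a + 1)%Z.

(** Taylor polynomials of degree 7 for [sin] and 6 for [cos], in Horner form. For
    [0 <= t <= 1/16] the remainders are smaller than [1 / B], which is what
    [widen] allows for. *)
Definition bsin1 (t : ball) : ball :=
  let s := bmul t t in
  widen (bmul t (bsub (bint 1) (bdiv (bmul s (bsub (bint 1) (bdiv
          (bmul s (bsub (bint 1) (bdiv s 42))) 20))) 6))).
Definition bcos1 (t : ball) : ball :=
  let s := bmul t t in
  widen (bsub (bint 1) (bdiv (bmul s (bsub (bint 1) (bdiv
          (bmul s (bsub (bint 1) (bdiv s 30))) 12))) 2)).

(** The [sin] and [cos] of [a, a + t, ..., a + n t], from those of [t], given by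
    [s1] and [c1], and those of [a], given by [s] and [c]. *)
Fixpoint rotations (s1 c1 s c : ball) (n : nat) : list (ball * ball) :=
  (s, c) ::
  match n with
  | O => []
  | S n' => rotations s1 c1 (badd (bmul s c1) (bmul c s1))
                            (bsub (bmul c c1) (bmul s s1)) n'
  end.

(** Enclosures of [u_0, ..., u_32]. *)
Definition table (t : ball) : list (ball * ball) :=
  rotations (bsin1 t) (bcos1 t) (bint 0) (bint 1) 32.

Definition bzero : ball * ball := (bint 0, bint 0).

(** Enclosures of the coordinates of [end_point], of [place], and of [gap]. *)
Fixpoint bend (T : list (ball * ball)) (w : word) : ball * ball :=
  match w with
  | [] => bzero
  | (e, j) :: w' =>
      let a := bend T w' in
      let v := nth j T bzero in
      if e then (bsub (fst a) (fst v), bsub (snd a) (snd v))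
           else (badd (fst a) (fst v), badd (snd a) (snd v))
  end.

Definition bplace (T : list (ball * ball)) (v : label) : ball * ball :=
  let a := bend T (snd v) in if fst v then (bopp (fst a), snd a) else a.

Definition bgap (T : list (ball * ball)) (w : word) : ball :=
  let a := bend T (tl w) in
  let b := bend T w in
  let x := badd (fst a) (fst b) in
  let y := bsub (snd a) (snd b) in
  bsub (badd (bmul x x) (bmul y y))
       (badd (bsub (bint 1) (snd (nth 1 T bzero))) (bsub (bint 1) (snd (nth 1 T bzero)))).

(** Tests that the triangle [a b c] is oriented clockwise. *)
Definition bturn (a b : ball * ball) : ball * ball -> bool :=
  let ex := bsub (fst b) (fst a) in
  let ey := bsub (snd b) (snd a) in
  fun c => bneg (bsub (bmul ex (bsub (snd c) (snd a)))
                      (bmul ey (bsub (fst c) (fst a)))).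

(** Tests that the distance is less than 1. *)
Definition bclose (a b : ball * ball) : bool :=
  let x := bsub (fst b) (fst a) in
  let y := bsub (snd b) (snd a) in
  bneg (bsub (badd (bmul x x) (bmul y y)) (bint 1)).

(** The steps of [w] have their index in [table]. *)
Definition bounded (w : word) : bool :=
  forallb (fun s => (snd s <=? 32)%nat) w.

(** For every side, the other vertices of the list [l] are strictly to the right
    of the line that carries it. *)
Definition convex_check (t : ball) (l : list label) : bool :=
  let n := length l in
  let P := map (bplace (table t)) l in
  forallb (fun v => bounded (snd v)) l &&
  forallb (fun i =>
    let j := (S i mod n)%nat in
    let f := bturn (nth i P bzero) (nth j P bzero) in
    forallb (fun k => (k =? i)%nat || (k =? j)%nat || f (nth k P bzero))
      (seq 0 n)) (seq 0 n).

Lemma B_pos : 0 < IZR B.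
Proof. apply IZR_lt; reflexivity. Qed.

Lemma mem_add a b x y : mem a x -> mem b y -> mem (badd a b) (x + y).
Proof.
unfold mem, badd; simpl; rewrite !plus_IZR; intros Ha Hb.
replace ((x + y) * IZR B - (IZR (fst a) + IZR (fst b)))
  with ((x * IZR B - IZR (fst a)) + (y * IZR B - IZR (fst b))) by ring.
eapply Rle_trans; [apply Rabs_triang | lra].
Qed.

Lemma mem_opp a x : mem a x -> mem (bopp a) (- x).
Proof.
unfold mem, bopp; simpl; rewrite opp_IZR; intros Ha.
replace (- x * IZR B - - IZR (fst a)) with (- (x * IZR B - IZR (fst a))) by ring.
now rewrite Rabs_Ropp.
Qed.

Lemma mem_sub a b x y : mem a x -> mem b y -> mem (bsub a b) (x - y).
Proof. intros Ha Hb; apply mem_add; [exact Ha | now apply mem_opp]. Qed.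

Lemma mem_int z : mem (bint z) (IZR z).
Proof.
unfold mem, bint; simpl; rewrite mult_IZR, Rminus_diag, Rabs_R0; lra.
Qed.

Lemma shiftr_B z :
  0 <= IZR z - IZR (Z.shiftr z 44) * IZR B < IZR B.
Proof.
rewrite Z.shiftr_div_pow2 by lia; fold B.
rewrite <- mult_IZR, <- minus_IZR.
pose proof (Z.div_mod z B ltac:(discriminate)) as E.
pose proof (Z.mod_pos_bound z B ltac:(reflexivity)) as M.
split; [apply IZR_le | apply IZR_lt]; lia.
Qed.

Lemma mem_mul a b x y : mem a x -> mem b y -> mem (bmul a b) (x * y).
Proof.
unfold mem; destruct a as [m r], b as [m' r']; cbn [bmul fst snd].
set (N := (Z.abs m * r' + Z.abs m' * r + r * r')%Z).
pose proof (shiftr_B (m * m')) as Hm; pose proof (shiftr_B N) as HN.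
pose proof B_pos as HB.
rewrite plus_IZR.
set (M := IZR (Z.shiftr (m * m') 44)) in *.
set (K := IZR (Z.shiftr N 44)) in *.
assert (EN : IZR N = Rabs (IZR m) * IZR r' + Rabs (IZR m') * IZR r + IZR r * IZR r').
{ unfold N; rewrite !plus_IZR, !mult_IZR, !abs_IZR; reflexivity. }
rewrite mult_IZR in Hm.
intros Hx Hy.
set (d := x * IZR B - IZR m) in *; set (d' := y * IZR B - IZR m') in *.
assert (E : (x * y * IZR B - M) * IZR B
            = (IZR m * IZR m' - M * IZR B) + (IZR m * d' + IZR m' * d + d * d')).
{ unfold d, d'; ring. }
assert (H : Rabs (IZR m * d' + IZR m' * d + d * d') <= IZR N).
{ rewrite EN.
  eapply Rle_trans; [apply Rabs_triang|].
  apply Rplus_le_compat.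
  - eapply Rle_trans; [apply Rabs_triang|].
    rewrite !Rabs_mult.
    apply Rplus_le_compat; apply Rmult_le_compat_l; auto using Rabs_pos.
  - rewrite Rabs_mult; apply Rmult_le_compat; auto using Rabs_pos. }
apply Rmult_le_reg_r with (IZR B); [exact HB|].
rewrite <- (Rabs_pos_eq (IZR B)) at 2 by lra.
rewrite <- Rabs_mult, E.
eapply Rle_trans; [apply Rabs_triang|].
rewrite (Rabs_pos_eq (_ - _)) by apply Hm.
lra.
Qed.

Lemma mem_div a n x : mem a x -> mem (bdiv a n) (x / IZR (Zpos n)).
Proof.
unfold mem; destruct a as [m r]; cbn [bdiv fst snd]; intros H.
pose proof (IZR_lt 0 (Zpos n) ltac:(reflexivity)) as Hn.
assert (Hdiv : forall z, 0 <= IZR z - IZR (z / Zpos n) * IZR (Zpos n) < IZR (Zpos n)).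
{ intros z; rewrite <- mult_IZR, <- minus_IZR.
  pose proof (Z.div_mod z (Zpos n) ltac:(discriminate)) as E.
  pose proof (Z.mod_pos_bound z (Zpos n) ltac:(reflexivity)) as M.
  split; [apply IZR_le | apply IZR_lt]; lia. }
pose proof (Hdiv m) as Hm; pose proof (Hdiv r) as Hr.
rewrite plus_IZR.
apply Rmult_le_reg_r with (IZR (Zpos n)); [exact Hn|].
rewrite <- (Rabs_pos_eq (IZR (Zpos n))) at 2 by lra.
rewrite <- Rabs_mult.
replace ((x / IZR (Zpos n) * IZR B - IZR (m / Zpos n)) * IZR (Zpos n))
  with ((x * IZR B - IZR m) + (IZR m - IZR (m / Zpos n) * IZR (Zpos n)))
  by (field; lra).
eapply Rle_trans; [apply Rabs_triang|].
rewrite (Rabs_pos_eq (IZR m - _)) by apply Hm.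
lra.
Qed.

Lemma mem_widen a x y : mem a x -> Rabs (y - x) <= / IZR B -> mem (widen a) y.
Proof.
unfold mem; cbn [widen fst snd]; intros Hx Hy.
pose proof B_pos as HB.
rewrite plus_IZR.
replace (y * IZR B - IZR (fst a))
  with ((x * IZR B - IZR (fst a)) + (y - x) * IZR B) by ring.
eapply Rle_trans; [apply Rabs_triang|].
apply Rplus_le_compat; [exact Hx|].
rewrite Rabs_mult, (Rabs_pos_eq (IZR B)) by lra.
replace 1 with (/ IZR B * IZR B) by (field; lra).
apply Rmult_le_compat_r; lra.
Qed.

Lemma bneg_neg a x : bneg a = true -> mem a x -> x < 0.
Proof.
unfold bneg, mem; intros H Hx.
apply Z.ltb_lt, IZR_lt in H; rewrite plus_IZR in H.
pose proof B_pos as HB.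
apply Rmult_lt_reg_r with (IZR B); [exact HB|].
pose proof (Rle_abs (x * IZR B - IZR (fst a))); lra.
Qed.

Lemma B_val : IZR B = 17592186044416.
Proof. apply f_equal; reflexivity. Qed.

Lemma INR_fact_S n : INR (fact (S n)) = INR (S n) * INR (fact n).
Proof. now rewrite fact_simpl, mult_INR. Qed.

Lemma sin_taylor t : 0 <= t <= / 16 ->
  0 <= sin t - t * (1 - (t * t * (1 - (t * t * (1 - t * t / 42)) / 20)) / 6)
    <= / IZR B.
Proof.
intros Ht; pose proof PI2_3_2.
destruct (sin_bound t 1) as [H1 H2]; [lra | lra |].
unfold sin_approx, sin_term in H1, H2.
change (2 * 1 + 1)%nat with 3%nat in H1; change (2 * (1 + 1))%nat with 4%nat in H2.
cbn [sum_f_R0 Nat.mul Nat.add pow] in H1, H2.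
rewrite !INR_fact_S in H1, H2; cbn [fact INR] in H1, H2.
rewrite ?mult_INR in H2; cbn [INR] in H2.
assert (H9 : t * (t * t) ^ 4 <= / 16 * (/ 16 * / 16) ^ 4).
{ apply Rmult_le_compat; [lra | apply pow_le; nra | lra |].
  apply pow_incr; nra. }
rewrite B_val; lra.
Qed.

Lemma cos_taylor t : 0 <= t <= / 16 ->
  0 <= cos t - (1 - (t * t * (1 - (t * t * (1 - t * t / 30)) / 12)) / 2)
    <= / IZR B.
Proof.
intros Ht; pose proof PI2_3_2.
destruct (cos_bound t 1) as [H1 H2]; [lra | lra |].
unfold cos_approx, cos_term in H1, H2.
change (2 * 1 + 1)%nat with 3%nat in H1; change (2 * (1 + 1))%nat with 4%nat in H2.
cbn [sum_f_R0 Nat.mul Nat.add pow] in H1, H2.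
rewrite !INR_fact_S in H1, H2; cbn [fact INR] in H1, H2.
rewrite ?mult_INR in H2; cbn [INR] in H2.
assert (H8 : (t * t) ^ 4 <= (/ 16 * / 16) ^ 4) by (apply pow_incr; nra).
rewrite B_val; lra.
Qed.

Lemma mem_sin1 a t : 0 <= t <= / 16 -> mem a t -> mem (bsin1 a) (sin t).
Proof.
intros Ht Ha.
eapply mem_widen; [|rewrite Rabs_pos_eq; apply (sin_taylor t Ht)].
repeat first [ exact Ha | apply mem_mul | apply mem_sub
             | apply mem_div | apply (mem_int 1) ].
Qed.

Lemma mem_cos1 a t : 0 <= t <= / 16 -> mem a t -> mem (bcos1 a) (cos t).
Proof.
intros Ht Ha.
eapply mem_widen; [|rewrite Rabs_pos_eq; apply (cos_taylor t Ht)].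
repeat first [ exact Ha | apply mem_mul | apply mem_sub
             | apply mem_div | apply (mem_int 1) ].
Qed.

(** * Enclosures of the vertices, and convexity *)

Definition mem2 (b : ball * ball) (a : point) : Prop :=
  mem (fst b) (fst a) /\ mem (snd b) (snd a).

Lemma mem2_zero : mem2 bzero (0, 0).
Proof. split; apply (mem_int 0). Qed.

Lemma rotations_mem s1 c1 t n : forall s c k,
  mem s1 (sin t) -> mem c1 (cos t) -> mem2 (s, c) (u t k) ->
  forall j, (j <= n)%nat -> mem2 (nth j (rotations s1 c1 s c n) bzero) (u t (k + j)).
Proof.
induction n as [|n IH]; intros s c k Hs1 Hc1 [Hs Hc] j Hj;
  (destruct j as [|j]; [rewrite Nat.add_0_r; split; assumption|]).
- lia.
- cbn [rotations nth]; rewrite <- Nat.add_succ_comm.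
  apply IH; [assumption.. | | lia].
  unfold u in *; cbn [fst snd] in *.
  rewrite S_INR; replace ((INR k + 1) * t) with (INR k * t + t) by ring.
  split; cbn [fst snd].
  + rewrite sin_plus; apply mem_add; apply mem_mul; assumption.
  + rewrite cos_plus; apply mem_sub; apply mem_mul; assumption.
Qed.

Lemma table_mem a t : 0 <= t <= / 16 -> mem a t ->
  forall j, (j <= 32)%nat -> mem2 (nth j (table a) bzero) (u t j).
Proof.
intros Ht Ha j Hj.
apply (rotations_mem _ _ t 32 _ _ 0);
  [now apply mem_sin1 | now apply mem_cos1 | | exact Hj].
unfold u; simpl INR; rewrite Rmult_0_l, sin_0, cos_0.
split; [apply (mem_int 0) | apply (mem_int 1)].
Qed.

Section Enclosure.

Variables (a : ball) (t : R).
Hypothesis Ht : 0 <= t <= / 16.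
Hypothesis Ha : mem a t.

Lemma bend_mem w : bounded w = true -> mem2 (bend (table a) w) (end_point t w).
Proof.
induction w as [|[e j] w IH]; intros Hw; [apply mem2_zero|].
apply andb_prop in Hw; destruct Hw as [Hj Hw].
apply Nat.leb_le in Hj; cbn [snd] in Hj.
destruct (IH Hw) as [H1 H2].
destruct (table_mem a t Ht Ha j Hj) as [H3 H4].
cbn [bend end_point]; unfold step.
destruct e; cbn [Nat.b2n pow]; split; cbn [fst snd].
- replace (fst (end_point t w) + -1 * 1 * fst (u t j))
    with (fst (end_point t w) - fst (u t j)) by ring.
  now apply mem_sub.
- replace (snd (end_point t w) + -1 * 1 * snd (u t j))
    with (snd (end_point t w) - snd (u t j)) by ring.
  now apply mem_sub.
- rewrite Rmult_1_l; now apply mem_add.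
- rewrite Rmult_1_l; now apply mem_add.
Qed.

Lemma bplace_mem v : bounded (snd v) = true ->
  mem2 (bplace (table a) v) (place t v).
Proof.
intros Hv; pose proof (bend_mem _ Hv) as [H1 H2].
unfold bplace, place; destruct (fst v); split; cbn [fst snd rho];
  [now apply mem_opp | assumption..].
Qed.

Lemma bounded_tl w : bounded w = true -> bounded (tl w) = true.
Proof.
destruct w; [easy|]; intros H; now apply andb_prop in H.
Qed.

Lemma bgap_mem w : bounded w = true -> mem (bgap (table a) w) (gap t w).
Proof.
intros Hw.
destruct (bend_mem _ Hw) as [H1 H2].
destruct (bend_mem _ (bounded_tl _ Hw)) as [H3 H4].
destruct (table_mem a t Ht Ha 1 ltac:(lia)) as [_ H5].
unfold u in H5; cbn [snd] in H5; rewrite Rmult_1_l in H5.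
unfold gap, bgap.
replace (2 * (1 - cos t)) with ((1 - cos t) + (1 - cos t)) by ring.
assert (H6 := mem_sub _ _ _ _ (mem_int 1) H5).
apply mem_sub; apply mem_add; try assumption.
- apply mem_mul; now apply mem_add.
- apply mem_mul; now apply mem_sub.
Qed.

Lemma bturn_neg b c d x y z : mem2 b x -> mem2 c y -> mem2 d z ->
  bturn b c d = true -> orient x y z < 0.
Proof.
intros [Hb Hb'] [Hc Hc'] [Hd Hd'] H.
apply (bneg_neg _ _ H).
apply mem_sub; apply mem_mul; now apply mem_sub.
Qed.

Lemma nth_place l i : forallb (fun v => bounded (snd v)) l = true ->
  mem2 (nth i (map (bplace (table a)) l) bzero) (nth i (map (place t) l) (0, 0)).
Proof.
intros Hl.
change bzero with (bplace (table a) (false, [])).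
change (0, 0) with (place t (false, [])).
rewrite !map_nth; apply bplace_mem.
destruct (Nat.lt_ge_cases i (length l)) as [Hi | Hi].
- rewrite forallb_forall in Hl; apply Hl, nth_In, Hi.
- now rewrite nth_overflow.
Qed.

Lemma convex_check_sound l : (3 <= length l)%nat ->
  convex_check a l = true -> convex (map (place t) l).
Proof.
intros H3 H; split; rewrite length_map; [exact H3|].
apply andb_prop in H; destruct H as [Hl H].
intros i Hi others o; right; intros k (Hk & Hki & Hkj).
rewrite forallb_forall in H.
specialize (H i ltac:(apply in_seq; lia)); cbv zeta in H.
rewrite forallb_forall in H.
specialize (H k ltac:(apply in_seq; lia)).
apply Nat.eqb_neq in Hki, Hkj.
rewrite Hki, Hkj in H; cbn [orb] in H.
revert H; unfold o, vertex; rewrite length_map.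
rewrite (Nat.mod_small i), (Nat.mod_small k) by assumption.
now apply bturn_neg; apply nth_place.
Qed.

End Enclosure.

(** * Sides and diameter *)

Lemma dist_sqr a b :
  dist a b = sqrt ((fst a - fst b) * (fst a - fst b) + (snd a - snd b) * (snd a - snd b)).
Proof. reflexivity. Qed.

Lemma dist_sym a b : dist a b = dist b a.
Proof. unfold dist; apply distance_symm. Qed.

Lemma dist_rho a b : dist (rho a) (rho b) = dist a b.
Proof. rewrite !dist_sqr; unfold rho; cbn [fst snd]; f_equal; ring. Qed.

Lemma chord t : 0 <= t <= PI -> sqrt (2 * (1 - cos t)) = 2 * sin (t / 2).
Proof.
intros Ht.
assert (0 <= sin (t / 2)) by (apply sin_ge_0; lra).
replace t with (2 * (t / 2)) at 1 by lra.
rewrite cos_2a_sin.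
replace (2 * (1 - (1 - 2 * sin (t / 2) * sin (t / 2))))
  with ((2 * sin (t / 2)) * (2 * sin (t / 2))) by ring.
apply sqrt_square; lra.
Qed.

Lemma u_unit t j : fst (u t j) * fst (u t j) + snd (u t j) * snd (u t j) = 1.
Proof. exact (sin2_cos2 (INR j * t)). Qed.

Lemma u_chord t j :
  (fst (u t j) - fst (u t (S j))) * (fst (u t j) - fst (u t (S j))) +
  (snd (u t j) - snd (u t (S j))) * (snd (u t j) - snd (u t (S j)))
  = 2 * (1 - cos t).
Proof.
pose proof (u_unit t j) as H1; pose proof (u_unit t (S j)) as H2.
assert (H3 : fst (u t j) * fst (u t (S j)) + snd (u t j) * snd (u t (S j)) = cos t).
{ unfold u; cbn [fst snd].
  replace t with (INR (S j) * t - INR j * t) at 5 by (rewrite S_INR; ring).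
  rewrite cos_minus; ring. }
lra.
Qed.

Fixpoint word_eqb (w w' : word) : bool :=
  match w, w' with
  | [], [] => true
  | (e, j) :: b, (e', j') :: b' =>
      if (j =? j')%nat then if eqb e e' then word_eqb b b' else false else false
  | _, _ => false
  end.

Lemma word_eqb_eq w : forall w', word_eqb w w' = true <-> w = w'.
Proof.
induction w as [|[e j] w IH]; intros [|[e' j'] w']; try easy; cbn [word_eqb].
destruct (Nat.eqb_spec j j') as [<-|Hj]; [|split; [easy | congruence]].
destruct (eqb_spec e e') as [<-|He]; [|split; [easy | congruence]].
rewrite IH; split; congruence.
Qed.

Definition label_eqb (v v' : label) : bool :=
  eqb (fst v) (fst v') && word_eqb (snd v) (snd v').

Lemma label_eqb_eq v v' : label_eqb v v' = true <-> v = v'.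
Proof.
destruct v as [f w], v' as [f' w']; unfold label_eqb; cbn [fst snd].
rewrite andb_true_iff, eqb_true_iff, word_eqb_eq; split; [intros []|]; intuition congruence.
Qed.

(** Words whose end point is the origin or [(0, 1)] or [(0, -1)], which the
    reflection fixes. *)
Definition on_axis (w : word) : bool :=
  match w with [] => true | [(_, j)] => (j =? 0)%nat | _ => false end.

(** The two vertices are on the same side of the axis, the points of the axis
    being on both. *)
Definition comparable (v v' : label) : bool :=
  eqb (fst v) (fst v') || on_axis (snd v) || on_axis (snd v').

(** [w'] extends [w] by one step. *)
Definition unit_apart (w w' : word) : bool :=
  match w' with _ :: b => word_eqb w b | [] => false end.

(** The end points are the other ends of two unit segments that leave a common
    point with directions [u_j] and [u_(j+1)], up to sign. In the first case both
    words extend a word [b], whose end is the common point. In the second case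
    [w'] is [w] followed by the steps [j] and [j + 1] with opposite signs, and
    the common point is the end of the step [j]. *)
Definition chord_apart (w w' : word) : bool :=
  match w, w' with
  | (e, j) :: b, (e', j') :: b' => eqb e e' && (j' =? S j)%nat && word_eqb b b'
  | _, _ => false
  end ||
  match w' with
  | (e', j') :: (e, j) :: b => eqb e (negb e') && (j' =? S j)%nat && word_eqb w b
  | _ => false
  end.

(** The vertices are [p_(m-1)] and the mirror image of [p_m], or the mirror
    images of these two points, where [w0] represents [p_m]. *)
Definition closing_apart (w0 : word) (v v' : label) : bool :=
  eqb (fst v) (negb (fst v')) && word_eqb (snd v) (tl w0) && word_eqb (snd v') w0.

Lemma on_axis_rho t w : on_axis w = true -> rho (end_point t w) = end_point t w.
Proof.
destruct w as [|[e j] [|]]; intros H; [| |easy].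
- unfold rho; cbn; f_equal; ring.
- apply Nat.eqb_eq in H; subst j.
  unfold rho; cbn [end_point]; unfold step, u; cbn [fst snd INR].
  rewrite Rmult_0_l, sin_0; f_equal; ring.
Qed.

Lemma comparable_dist t v v' : comparable v v' = true ->
  dist (place t v) (place t v') = dist (end_point t (snd v)) (end_point t (snd v')).
Proof.
unfold comparable, place; intros H.
destruct (fst v), (fst v'); try reflexivity; try apply dist_rho;
  apply orb_prop in H; destruct H as [H | H]; try discriminate;
  apply (on_axis_rho t) in H.
- now rewrite H.
- now rewrite <- H, dist_rho, H.
- now rewrite <- H, dist_rho, H.
- now rewrite H.
Qed.

Lemma step_fst a e v : fst (step a e v) = fst a + (-1) ^ e * fst v.
Proof. reflexivity. Qed.

Lemma step_snd a e v : snd (step a e v) = snd a + (-1) ^ e * snd v.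
Proof. reflexivity. Qed.

Lemma unit_apart_dist t w w' : unit_apart w w' = true ->
  dist (end_point t w) (end_point t w') = 1.
Proof.
destruct w' as [|[e j] b]; [easy|]; intros H; apply word_eqb_eq in H; subst b.
rewrite dist_sqr; cbn [end_point]; rewrite step_fst, step_snd.
rewrite <- sqrt_1; f_equal; rewrite <- (u_unit t j).
destruct e; cbn [Nat.b2n pow]; ring.
Qed.

Lemma chord_apart_dist t w w' : 0 <= t <= PI -> chord_apart w w' = true ->
  dist (end_point t w) (end_point t w') = 2 * sin (t / 2).
Proof.
intros Ht H; rewrite <- chord by exact Ht; rewrite dist_sqr.
apply orb_prop in H; destruct H as [H | H].
- destruct w as [|[e j] b], w' as [|[e' j'] b']; try easy.
  apply andb_prop in H; destruct H as [H Hb]; apply andb_prop in H; destruct H as [He Hj].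
  apply eqb_prop in He; apply Nat.eqb_eq in Hj; apply word_eqb_eq in Hb; subst.
  rewrite <- (u_chord t j); f_equal.
  cbn [end_point]; rewrite !step_fst, !step_snd.
  destruct e'; cbn [Nat.b2n pow]; ring.
- destruct w' as [|[e' j'] [|[e j] b]]; try easy.
  apply andb_prop in H; destruct H as [H Hb]; apply andb_prop in H; destruct H as [He Hj].
  apply eqb_prop in He; apply Nat.eqb_eq in Hj; apply word_eqb_eq in Hb; subst.
  rewrite <- (u_chord t j); f_equal.
  cbn [end_point]; rewrite !step_fst, !step_snd.
  destruct e'; cbn [Nat.b2n negb pow]; ring.
Qed.

Lemma dist_gap t w :
  dist (end_point t (tl w)) (rho (end_point t w)) = sqrt (gap t w + 2 * (1 - cos t)).
Proof.
rewrite dist_sqr; unfold gap, rho; cbn [fst snd]; f_equal; ring.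
Qed.

Lemma gap_closes t w : 0 <= t <= PI ->
  gap t w = 0 <-> dist (end_point t (tl w)) (rho (end_point t w)) = 2 * sin (t / 2).
Proof.
intros Ht; rewrite dist_gap, <- chord by exact Ht.
assert (H : 0 <= gap t w + 2 * (1 - cos t)).
{ unfold gap.
  pose proof (Rle_0_sqr (fst (end_point t (tl w)) + fst (end_point t w))).
  pose proof (Rle_0_sqr (snd (end_point t (tl w)) - snd (end_point t w))).
  unfold Rsqr in *; lra. }
pose proof (COS_bound t).
split; intros E; [now rewrite E, Rplus_0_l|].
apply sqrt_inj in E; lra.
Qed.

Lemma closing_apart_dist t w0 v v' : 0 <= t <= PI -> gap t w0 = 0 ->
  closing_apart w0 v v' = true -> dist (place t v) (place t v') = 2 * sin (t / 2).
Proof.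
intros Ht Hg H; apply gap_closes in Hg; [|exact Ht].
apply andb_prop in H; destruct H as [H H2]; apply andb_prop in H; destruct H as [H H1].
apply eqb_prop in H; apply word_eqb_eq in H1, H2.
unfold place; rewrite H, H1, H2, <- Hg.
destruct (fst v'); cbn [negb]; [reflexivity|].
rewrite <- dist_rho.
f_equal; unfold rho; cbn [fst snd]; rewrite Ropp_involutive.
now destruct (end_point t (tl w0)).
Qed.

(** Any two consecutive labels of the cyclic list [l] are in one of the positions
    that give the distance [2 sin (t/2)]. *)
Definition side_check (w0 : word) (l : list label) : bool :=
  let n := length l in
  forallb (fun i =>
    let v := nth i l (false, []) in
    let v' := nth (S i mod n) l (false, []) in
    closing_apart w0 v v' || closing_apart w0 v' v ||
    comparable v v' && (chord_apart (snd v) (snd v') || chord_apart (snd v') (snd v)))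
  (seq 0 n).

Lemma nth_mod_vertex t l i :
  vertex (map (place t) l) i = place t (nth (i mod length l) l (false, [])).
Proof.
unfold vertex; rewrite length_map.
change (0, 0) with (place t (false, [])); apply map_nth.
Qed.

Lemma side_check_sound t w0 l : 0 <= t <= PI -> gap t w0 = 0 ->
  side_check w0 l = true ->
  forall i, (i < length l)%nat -> side (map (place t) l) i = 2 * sin (t / 2).
Proof.
intros Ht Hg H i Hi.
unfold side_check in H; rewrite forallb_forall in H.
specialize (H i ltac:(apply in_seq; lia)); cbv zeta in H.
unfold side; rewrite !nth_mod_vertex, (Nat.mod_small i) by exact Hi.
apply orb_prop in H; destruct H as [H | H].
- apply orb_prop in H; destruct H as [H | H].
  + now apply (closing_apart_dist t w0).
  + rewrite dist_sym; now apply (closing_apart_dist t w0).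
- apply andb_prop in H; destruct H as [Hc H].
  rewrite comparable_dist by exact Hc.
  apply orb_prop in H; destruct H as [H | H].
  + now apply chord_apart_dist.
  + rewrite dist_sym; now apply chord_apart_dist.
Qed.

Lemma perimeter_const P s : (forall i, (i < length P)%nat -> side P i = s) ->
  perimeter P = INR (length P) * s.
Proof.
unfold perimeter; intros H.
assert (G : forall l, (forall i, In i l -> side P i = s) ->
  fold_right Rplus 0 (map (side P) l) = INR (length l) * s).
{ induction l as [|i l IH]; intros Hl; [simpl; ring|].
  cbn [map fold_right length]; rewrite S_INR, Hl by now left.
  rewrite IH by (intros k Hk; apply Hl; now right); ring. }
rewrite G, length_seq; [reflexivity|].
intros i Hi; apply H; apply in_seq in Hi; lia.
Qed.

(** Any two vertices are joined by a segment of the walk or of its mirror image,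
    or are less than 1 apart. *)
Definition diameter_check (a : ball) (l : list label) : bool :=
  let T := table a in
  let L := map (fun v => (v, bplace T v)) l in
  forallb (fun x : label * (ball * ball) =>
    let (v, b) := x in
    forallb (fun x' : label * (ball * ball) =>
      let (v', b') := x' in
      comparable v v' && (unit_apart (snd v) (snd v') || unit_apart (snd v') (snd v))
      || bclose b b') L) L.

Lemma fold_Rmax_le l m : 0 <= m -> (forall x, In x l -> x <= m) ->
  fold_right Rmax 0 l <= m.
Proof.
intros Hm; induction l as [|x l IH]; intros H; [exact Hm|].
apply Rmax_lub; [apply H; now left | apply IH; intros y Hy; apply H; now right].
Qed.

Lemma fold_Rmax_ge l x : In x l -> x <= fold_right Rmax 0 l.
Proof.
induction l as [|y l IH]; [easy|]; intros [H | H]; cbn [fold_right].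
- subst y; apply Rmax_l.
- eapply Rle_trans; [apply IH, H | apply Rmax_r].
Qed.

Lemma small_intro P : (forall x y, In x P -> In y P -> dist x y <= 1) ->
  (exists x y, In x P /\ In y P /\ dist x y = 1) -> small P.
Proof.
intros H (x & y & Hx & Hy & Hxy); apply Rle_antisym.
- apply fold_Rmax_le; [lra|].
  intros d Hd; apply in_map_iff in Hd; destruct Hd as ([z z'] & <- & Hz).
  apply in_prod_iff in Hz; now apply H.
- rewrite <- Hxy; apply fold_Rmax_ge.
  apply (in_map (fun ab => dist (fst ab) (snd ab)) _ (x, y)); now apply in_prod.
Qed.

Lemma bclose_dist b c x y : mem2 b x -> mem2 c y ->
  bclose b c = true -> dist x y <= 1.
Proof.
intros [Hb Hb'] [Hc Hc'] H.
rewrite dist_sym, dist_sqr, <- sqrt_1; apply sqrt_le_1_alt.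
assert (G : (fst y - fst x) * (fst y - fst x) + (snd y - snd x) * (snd y - snd x) - 1 < 0); [|lra].
apply (bneg_neg _ _ H), mem_sub; [|apply (mem_int 1)].
apply mem_add; apply mem_mul; now apply mem_sub.
Qed.

Lemma diameter_check_sound a t l : 0 <= t <= / 16 -> mem a t ->
  forallb (fun v => bounded (snd v)) l = true -> diameter_check a l = true ->
  forall x y, In x (map (place t) l) -> In y (map (place t) l) -> dist x y <= 1.
Proof.
intros Ht Ha Hl H x y Hx Hy.
apply in_map_iff in Hx, Hy.
destruct Hx as (v & <- & Hv), Hy as (v' & <- & Hv').
unfold diameter_check in H; cbv zeta in H; rewrite forallb_forall in H.
specialize (H _ (in_map (fun v : label => (v, bplace (table a) v)) _ _ Hv)); cbv beta iota in H.
rewrite forallb_forall in H.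
specialize (H _ (in_map (fun v : label => (v, bplace (table a) v)) _ _ Hv')); cbv beta iota in H.
rewrite forallb_forall in Hl.
apply orb_prop in H; destruct H as [H | H].
- apply andb_prop in H; destruct H as [Hc H].
  rewrite comparable_dist by exact Hc.
  apply orb_prop in H; destruct H as [H | H]; [|rewrite dist_sym];
    rewrite unit_apart_dist by exact H; lra.
- now apply (bclose_dist _ _ _ _ (bplace_mem a t Ht Ha v (Hl _ Hv))
                         (bplace_mem a t Ht Ha v' (Hl _ Hv'))).
Qed.

(** * Roots of the closing equation *)

Lemma continuity_end_point w :
  continuity (fun t => fst (end_point t w)) /\ continuity (fun t => snd (end_point t w)).
Proof.
induction w as [|[e j] w [IH1 IH2]]; cbn [end_point].
- split; apply continuity_const; easy.
- assert (Hl : continuity (fun t => INR j * t)).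
  { apply continuity_mult; [now apply continuity_const |].
    apply derivable_continuous, derivable_id. }
  unfold step, u; cbn [fst snd]; split.
  + apply continuity_plus; [exact IH1|].
    apply continuity_mult; [now apply continuity_const |].
    apply (continuity_comp _ sin Hl continuity_sin).
  + apply continuity_plus; [exact IH2|].
    apply continuity_mult; [now apply continuity_const |].
    apply (continuity_comp _ cos Hl continuity_cos).
Qed.

Lemma continuity_gap w : continuity (fun t => gap t w).
Proof.
destruct (continuity_end_point w) as [H1 H2].
destruct (continuity_end_point (tl w)) as [H3 H4].
unfold gap.
apply continuity_minus.
- apply continuity_plus; apply continuity_mult;
    first [now apply continuity_plus | now apply continuity_minus].
- apply continuity_mult; [now apply continuity_const |].
  apply continuity_minus; [now apply continuity_const | apply continuity_cos].
Qed.

(** The supremum of the zeros in [[a, b]] is a zero by continuity. *)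
Lemma largest_zero (f : R -> R) a b : continuity f -> a < b -> 0 < f a -> f b < 0 ->
  exists r, a <= r <= b /\ f r = 0 /\ forall t, a <= t <= b -> f t = 0 -> t <= r.
Proof.
intros Hf Hab Ha Hb.
destruct (IVT (- f)%F a b) as [z [Hz Hz0]];
  [now apply continuity_opp | exact Hab | unfold opp_fct; lra | unfold opp_fct; lra |].
unfold opp_fct in Hz0.
destruct (completeness (fun t => a <= t <= b /\ f t = 0)) as [r [Hub Hlub]].
- exists b; intros t [Ht _]; lra.
- exists z; split; [exact Hz | lra].
- assert (Hr : a <= r <= b).
  { split.
    - apply Rle_trans with z; [apply Hz | apply Hub; split; [exact Hz | lra]].
    - apply Hlub; intros t [Ht _]; lra. }
  exists r; split; [exact Hr | split].
  + destruct (Req_dec (f r) 0) as [|Hr0]; [assumption | exfalso].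
    destruct (Hf r (Rabs (f r)) (Rabs_pos_lt _ Hr0)) as [d [Hd H]].
    assert (r <= r - d / 2); [|lra].
    apply Hlub; intros t [Ht Ht0].
    assert (t <= r) by (apply Hub; now split).
    destruct (Rle_lt_dec t (r - d / 2)) as [|Hlt]; [assumption | exfalso].
    destruct (Req_dec r t) as [->|Hne]; [now apply Hr0|].
    assert (G : Rabs (f t - f r) < Rabs (f r)).
    { apply H; split; [split; [exact I | exact Hne]|].
      simpl; unfold Rdist; rewrite Rabs_left1; lra. }
    rewrite Ht0, Rminus_0_l, Rabs_Ropp in G; lra.
  + intros t Ht Ht0; apply Hub; now split.
Qed.

(** The ball around the interval from [lo / B] to [hi / B]. *)
Definition span (lo hi : Z) : ball := ((lo + hi) / 2, (hi - lo) / 2 + 1)%Z.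

Lemma span_mem lo hi t : IZR lo <= t * IZR B <= IZR hi -> mem (span lo hi) t.
Proof.
unfold mem, span; cbn [fst snd]; intros H.
pose proof (Z.div_mod (lo + hi) 2 ltac:(easy)).
pose proof (Z.div_mod (hi - lo) 2 ltac:(easy)).
pose proof (Z.mod_pos_bound (lo + hi) 2 ltac:(easy)).
pose proof (Z.mod_pos_bound (hi - lo) 2 ltac:(easy)).
assert (Hhi : (hi - (lo + hi) / 2 <= (hi - lo) / 2 + 1)%Z) by lia.
assert (Hlo : ((lo + hi) / 2 - lo <= (hi - lo) / 2 + 1)%Z) by lia.
apply IZR_le in Hhi, Hlo; rewrite minus_IZR in Hhi, Hlo.
apply Rabs_le; lra.
Qed.

(** Tests that [gap] is negative on [n] successive intervals, from [lo / B] on.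
    The first one has length [s / B]. The lengths increase by the factor [17/16],
    because near its root [gap] grows in absolute value like the distance to the
    root, and so does the width of the enclosure that can be afforded. *)
Fixpoint sweep (w : word) (n : nat) (lo s : Z) : bool :=
  match n with
  | O => true
  | S n' => bneg (bgap (table (span lo (lo + s))) w) && sweep w n' (lo + s) (s + s / 16)
  end.

(** [B] times the end of the last interval of [sweep]. *)
Fixpoint sweep_end (n : nat) (lo s : Z) : Z :=
  match n with
  | O => lo
  | S n' => sweep_end n' (lo + s) (s + s / 16)
  end.

Lemma sweep_sound w n t : bounded w = true -> 0 <= t <= / 16 -> forall lo s,
  sweep w n lo s = true -> IZR lo <= t * IZR B < IZR (sweep_end n lo s) -> gap t w < 0.
Proof.
intros Hw Ht; induction n as [|n IH]; intros lo s H Hb; cbn [sweep_end sweep] in *; [lra|].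
apply andb_prop in H; destruct H as [H1 H2].
destruct (Rle_lt_dec (IZR (lo + s)) (t * IZR B)) as [Hc | Hc].
- apply (IH _ _ H2); lra.
- apply (bneg_neg _ _ H1), bgap_mem; [exact Ht | apply span_mem; lra | exact Hw].
Qed.

Lemma below_PI_64 t : 0 <= t <= / 16 -> 0 < cos (32 * t) -> t < PI / 64.
Proof.
intros Ht Hc; pose proof PI2_3_2.
destruct (Rlt_le_dec t (PI / 64)) as [|Hle]; [assumption | exfalso].
pose proof (cos_le_0 (32 * t) ltac:(lra) ltac:(lra)); lra.
Qed.

Lemma above_PI_64 t : 0 <= t <= / 16 -> cos (32 * t) < 0 -> PI / 64 < t.
Proof.
intros Ht Hc.
destruct (Rlt_le_dec (PI / 64) t) as [|Hle]; [assumption | exfalso].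
pose proof PI2_3_2.
pose proof (cos_ge_0 (32 * t) ltac:(lra) ltac:(lra)); lra.
Qed.

(** * The polygon [A_n] *)

(** The words of the points [p_i] and [q_k] of [A_n]. The exponent of [-1] is
    replaced by its parity. *)
Fixpoint pword (n i : nat) : word :=
  match i with
  | O => []
  | S i' => (Nat.odd i', kept_index n i) :: pword n i'
  end.

Definition qword (n k : nat) : word :=
  (Nat.odd k, 4 * k - 2)%nat :: pword n (3 * k - 2).

Lemma pow_m1_odd i : (-1) ^ Nat.b2n (Nat.odd i) = (-1) ^ i.
Proof.
induction i as [|i IH]; [reflexivity|].
rewrite Nat.odd_succ, <- Nat.negb_odd; cbn [pow]; rewrite <- IH.
destruct (Nat.odd i); cbn [negb Nat.b2n pow]; ring.
Qed.

Lemma step_odd a i v : step a (Nat.b2n (Nat.odd i)) v = step a i v.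
Proof. unfold step; now rewrite pow_m1_odd. Qed.

Lemma p_word n t i : p n t i = end_point t (pword n i).
Proof.
induction i as [|i IH]; [reflexivity|].
cbn [p pword end_point]; now rewrite step_odd, IH.
Qed.

Lemma q_word n t k : q n t k = end_point t (qword n k).
Proof.
unfold q, qword; cbn [end_point]; now rewrite step_odd, p_word.
Qed.

Definition half_words (n : nat) : list word :=
  map (pword n) (seq 1 (3 * n / 8 - 1)) ++ map (qword n) (seq 1 (n / 8)).

(** The labels of [A_vertices], in the same order. *)
Definition A_labels (n : nat) : list label :=
  [(false, []); (false, [(false, 0%nat)])] ++
  map (pair false) (half_words n) ++ map (pair true) (half_words n).

Lemma A_vertices_labels n t : A_vertices n t = map (place t) (A_labels n).
Proof.
assert (H : half_vertices n t = map (end_point t) (half_words n)).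
{ unfold half_vertices, half_words; rewrite map_app, !map_map.
  f_equal; apply map_ext; intros i; [apply p_word | apply q_word]. }
assert (H0 : end_point t [(false, 0%nat)] = (0, 1)).
{ cbn [end_point]; unfold step, u; cbn [fst snd INR Nat.b2n pow].
  rewrite Rmult_0_l, sin_0, cos_0; f_equal; ring. }
unfold A_vertices, A_labels; rewrite H, !map_app, !map_map.
cbn [map app]; unfold place; cbn [fst snd]; rewrite H0; reflexivity.
Qed.

Fixpoint distinct (l : list label) : bool :=
  match l with
  | [] => true
  | v :: l' => negb (existsb (label_eqb v) l') && distinct l'
  end.

Lemma in_existsb v l : existsb (label_eqb v) l = true <-> In v l.
Proof.
rewrite existsb_exists; split.
- intros (v' & Hv & E); apply label_eqb_eq in E; now subst.
- intros Hv; exists v; split; [exact Hv | now apply label_eqb_eq].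
Qed.

Lemma distinct_NoDup l : distinct l = true -> NoDup l.
Proof.
induction l as [|v l IH]; intros H; constructor; apply andb_prop in H; destruct H as [H1 H2].
- rewrite <- in_existsb; now destruct existsb.
- now apply IH.
Qed.

(** The cyclic list of labels of the walk for [A_64] lists its vertices. *)
Lemma A_labels_tour : Permutation (tour keepA) (A_labels 64).
Proof.
apply NoDup_Permutation_bis.
- apply distinct_NoDup; vm_compute; reflexivity.
- vm_compute; lia.
- assert (E : (let L := A_labels 64 in
               forallb (fun v => existsb (label_eqb v) L) (tour keepA)) = true)
    by (vm_compute; reflexivity).
  rewrite forallb_forall in E.
  intros v Hv; apply in_existsb, E, Hv.
Qed.

(** * Numerical certificates *)

(** Bounds for [B] times the roots [t] of the closing equations of the two
    polygons. The roots are about [863552888975 / B] and [863553602879 / B]. *)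
Definition loA : Z := 863552884000.
Definition hiA : Z := 863552894000.
Definition loP : Z := 863553598000.
Definition hiP : Z := 863553608000.

Ltac compute_Z := vm_compute; first [reflexivity | discriminate].

Lemma bracket_range lo hi t : (0 <= lo)%Z -> (hi <= 2 ^ 40)%Z ->
  IZR lo <= t * IZR B <= IZR hi -> 0 <= t <= / 16.
Proof.
intros H1 H2 Ht; apply IZR_le in H1, H2.
change (2 ^ 40)%Z with 1099511627776%Z in H2.
rewrite B_val in Ht; lra.
Qed.

(** A change of the sign of [gap] between [lo / B] and [hi / B] gives a root, and
    there is a largest root between these two numbers. *)
Lemma gap_bracket w lo hi : bounded w = true ->
  (0 <= lo)%Z -> (lo < hi)%Z -> (hi <= 2 ^ 40)%Z ->
  bneg (bopp (bgap (table (span lo lo)) w)) = true ->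
  bneg (bgap (table (span hi hi)) w) = true ->
  exists r, IZR lo <= r * IZR B <= IZR hi /\ gap r w = 0 /\
    forall t, IZR lo <= t * IZR B <= IZR hi -> gap t w = 0 -> t <= r.
Proof.
intros Hw H0 Hlt H40 Hlo Hhi.
pose proof B_pos as HB.
assert (E : forall z, IZR z / IZR B * IZR B = IZR z) by (intros z; field; lra).
assert (Hmem : forall z, mem (span z z) (IZR z / IZR B)).
{ intros z; apply span_mem; rewrite E; lra. }
assert (Hr : forall z, (lo <= z <= hi)%Z -> 0 <= IZR z / IZR B <= / 16).
{ intros z Hz; apply (bracket_range lo hi); [exact H0 | exact H40 |].
  rewrite E; split; apply IZR_le; lia. }
destruct (largest_zero (fun t => gap t w) (IZR lo / IZR B) (IZR hi / IZR B))
  as (r & Hr1 & Hr2 & Hr3).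
- apply continuity_gap.
- apply Rmult_lt_compat_r; [now apply Rinv_0_lt_compat | now apply IZR_lt].
- pose proof (bneg_neg _ _ Hlo (mem_opp _ _ (bgap_mem _ _ (Hr lo ltac:(lia)) (Hmem lo) _ Hw))).
  lra.
- exact (bneg_neg _ _ Hhi (bgap_mem _ _ (Hr hi ltac:(lia)) (Hmem hi) _ Hw)).
- assert (Hiff : forall t, IZR lo / IZR B <= t <= IZR hi / IZR B <->
                           IZR lo <= t * IZR B <= IZR hi).
  { intros t; rewrite <- (E lo) at 2; rewrite <- (E hi) at 2.
    split; intros [G1 G2]; split;
      first [ apply Rmult_le_compat_r; lra
            | apply Rmult_le_reg_r with (IZR B); [exact HB | assumption] ]. }
  exists r; split; [now apply Hiff | split; [exact Hr2|]].
  intros t Ht; apply Hr3; now apply Hiff.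
Qed.

Lemma grid_value z : IZR z / IZR B * IZR B = IZR z.
Proof. pose proof B_pos; field; lra. Qed.

Lemma grid_range z : (0 <= z)%Z -> (z <= 2 ^ 40)%Z -> 0 <= IZR z / IZR B <= / 16.
Proof.
intros H0 H40; apply (bracket_range z z); [assumption.. | rewrite grid_value; lra].
Qed.

(** An enclosure of [cos (32 t)] for [t = z / B]. *)
Definition bcos32 (z : Z) : ball := snd (nth 32 (table (span z z)) bzero).

Lemma cos32_mem z : (0 <= z)%Z -> (z <= 2 ^ 40)%Z ->
  mem (bcos32 z) (cos (32 * (IZR z / IZR B))).
Proof.
intros H0 H40.
assert (Hm : mem (span z z) (IZR z / IZR B))
  by (apply span_mem; rewrite grid_value; lra).
destruct (table_mem _ _ (grid_range z H0 H40) Hm 32 ltac:(lia)) as [_ H].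
replace 32 with (INR 32) by (rewrite INR_IZR_INZ; reflexivity); exact H.
Qed.

Lemma grid_below_PI_64 z t : (0 <= z)%Z -> (z <= 2 ^ 40)%Z ->
  bneg (bopp (bcos32 z)) = true -> t * IZR B <= IZR z -> t < PI / 64.
Proof.
intros H0 H40 Hc Ht.
apply Rle_lt_trans with (IZR z / IZR B).
- apply Rmult_le_reg_r with (IZR B); [apply B_pos | rewrite grid_value; exact Ht].
- apply below_PI_64; [now apply grid_range|].
  pose proof (bneg_neg _ _ Hc (mem_opp _ _ (cos32_mem z H0 H40))); lra.
Qed.

Lemma grid_above_PI_64 z t : (0 <= z)%Z -> (z <= 2 ^ 40)%Z ->
  bneg (bcos32 z) = true -> t < PI / 64 -> t * IZR B < IZR z.
Proof.
intros H0 H40 Hc Ht.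
pose proof (above_PI_64 _ (grid_range z H0 H40) (bneg_neg _ _ Hc (cos32_mem z H0 H40))).
rewrite <- (grid_value z).
apply Rmult_lt_compat_r; [apply B_pos | lra].
Qed.

(** The end of a subdivision that starts at [hiA] and goes beyond [B PI / 64]. *)
Definition endA : Z := sweep_end 110 hiA 300.

Lemma path_keepA : path keepA = pword 64 23 /\ tl (path keepA) = pword 64 22.
Proof. vm_compute; auto. Qed.

Lemma closing_gap t : 0 < t < PI / 64 -> (closing 64 t <-> gap t (path keepA) = 0).
Proof.
intros Ht; unfold closing.
change (3 * 64 / 8 - 2)%nat with 22%nat; change (3 * 64 / 8 - 1)%nat with 23%nat.
rewrite !p_word, (proj1 path_keepA).
symmetry; apply (gap_closes t (pword 64 23)); lra.
Qed.

Lemma largest_closing_A : exists t, largest_closing 64 t /\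
  IZR loA <= t * IZR B <= IZR hiA /\ gap t (path keepA) = 0.
Proof.
destruct (gap_bracket (path keepA) loA hiA) as (r & Hr & Hr0 & Hmax);
  [compute_Z.. |].
assert (Hr16 : 0 <= r <= / 16)
  by (apply (bracket_range loA hiA); [compute_Z | compute_Z | exact Hr]).
assert (Hpos : 0 < r).
{ apply Rmult_lt_reg_r with (IZR B); [apply B_pos|].
  pose proof (IZR_lt 0 loA ltac:(reflexivity)); lra. }
assert (HPI : r < PI / 64).
{ apply (grid_below_PI_64 hiA); [compute_Z.. | apply Hr]. }
exists r; split; [|split; assumption].
unfold largest_closing; replace (INR 64) with 64 by (rewrite INR_IZR_INZ; reflexivity).
split; [split; [lra | apply closing_gap; lra]|].
intros t Ht Hc; apply closing_gap in Hc; [|exact Ht].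
destruct (Rle_lt_dec t r) as [|Hlt]; [assumption|].
assert (IZR loA <= t * IZR B).
{ apply Rle_trans with (r * IZR B); [apply Hr|].
  pose proof B_pos; apply Rmult_le_compat_r; lra. }
destruct (Rle_lt_dec (t * IZR B) (IZR hiA)) as [Hle | Hgt]; [now apply Hmax; [lra|]|].
(* Beyond [hiA] there is no root below [PI / 64]. *)
assert (Hend : t * IZR B < IZR endA)
  by (apply grid_above_PI_64; [compute_Z.. | apply Ht]).
assert (gap t (path keepA) < 0); [|lra].
apply (sweep_sound (path keepA) 110 t) with hiA 300%Z.
- vm_compute; reflexivity.
- apply (bracket_range loA endA); [compute_Z | compute_Z | lra].
- vm_compute; reflexivity.
- fold endA; lra.
Qed.

Lemma convex_polygon keep lo hi t : (3 <= length (tour keep))%nat ->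
  (0 <= lo)%Z -> (hi <= 2 ^ 40)%Z -> IZR lo <= t * IZR B <= IZR hi ->
  convex_check (span lo hi) (tour keep) = true -> convex (polygon_of t keep).
Proof.
intros H3 H0 H40 Ht H.
apply (convex_check_sound (span lo hi)); try assumption.
- now apply (bracket_range lo hi).
- now apply span_mem.
Qed.

Lemma perimeter_polygon keep t : 0 <= t <= PI -> gap t (path keep) = 0 ->
  side_check (path keep) (tour keep) = true ->
  perimeter (polygon_of t keep) = INR (length (tour keep)) * (2 * sin (t / 2)).
Proof.
intros Ht Hg H.
rewrite (perimeter_const _ (2 * sin (t / 2))); unfold polygon_of; rewrite length_map;
  [reflexivity|].
exact (side_check_sound t _ _ Ht Hg H).
Qed.

Theorem proposition2 :
  exists A : polygon,
    is_A 64 A /\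
    exists P : polygon,
      length P = 64%nat /\ convex P /\ equilateral P /\ small P /\
      perimeter A < perimeter P.
Proof.
destruct largest_closing_A as (t & Hlarge & Ht & Htgap).
destruct (gap_bracket (path keepP) loP hiP) as (s & Hs & Hsgap & _);
  [compute_Z.. |].
pose proof B_pos as HB.
assert (Ht16 : 0 <= t <= / 16)
  by (apply (bracket_range loA hiA); [compute_Z | compute_Z | exact Ht]).
assert (Hs16 : 0 <= s <= / 16)
  by (apply (bracket_range loP hiP); [compute_Z | compute_Z | exact Hs]).
(* The intervals that contain the two roots are disjoint. *)
assert (Hts : t < s).
{ apply Rmult_lt_reg_r with (IZR B); [exact HB|].
  pose proof (IZR_lt hiA loP ltac:(easy)); lra. }
pose proof PI2_3_2.
assert (HsideP : side_check (path keepP) (tour keepP) = true) by (vm_compute; reflexivity).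
exists (polygon_of t keepA); split; [split|].
- apply (convex_polygon keepA loA hiA);
    [apply Nat.leb_le; reflexivity | compute_Z | compute_Z | exact Ht | vm_compute; reflexivity].
- exists t; split; [exact Hlarge|].
  rewrite A_vertices_labels; apply Permutation_map, A_labels_tour.
- exists (polygon_of s keepP); split; [reflexivity | split; [|split; [|split]]].
  + apply (convex_polygon keepP loP hiP);
      [apply Nat.leb_le; reflexivity | compute_Z | compute_Z | exact Hs | vm_compute; reflexivity].
  + intros i j Hi Hj; unfold polygon_of in Hi, Hj; rewrite length_map in Hi, Hj.
    unfold polygon_of.
    rewrite !(side_check_sound s (path keepP)) by (assumption || lra).
    reflexivity.
  + apply small_intro.
    * apply (diameter_check_sound (span loP hiP));
        [exact Hs16 | now apply span_mem | vm_compute; reflexivity | vm_compute; reflexivity].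
    * exists (place s (false, [])), (place s (false, [(false, 0%nat)])).
      repeat split.
      -- apply in_map; vm_compute; tauto.
      -- apply in_map; vm_compute; tauto.
      -- now apply (unit_apart_dist s [] [(false, 0%nat)]).
  + rewrite !perimeter_polygon;
      [| lra | exact Hsgap | exact HsideP | lra | exact Htgap | vm_compute; reflexivity].
    change (length (tour keepA)) with 64%nat; change (length (tour keepP)) with 64%nat.
    apply Rmult_lt_compat_l; [apply lt_0_INR; lia|].
    apply Rmult_lt_compat_l; [lra|].
    apply sin_increasing_1; lra.
Qed.
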